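(* Let $n\ge 1$ and let $\Omega\subseteq\mathbb{R}^{n+1}$ be a nonempty, open, bounded set. Denote points of $\mathbb{R}^{n+1}$ by $(x,t)\in\mathbb{R}^n\times\mathbb{R}$ and let $H=\Delta_x-\partial_t$ be the heat operator, where $\Delta_x$ is the Laplacian in the first $n$ variables. Then there exists a constant $c>0$, depending only on $n$ and $\Omega$, such that for every smooth function $u:\Omega\to\mathbb{R}$ satisfying $Hu\ge 1$ on $\Omega$ and every $1\le p\le\infty$ with conjugate exponent $p'$, $$\|u\|_{L^p(\Omega)}\cdot|\{(x,t)\in\Omega:|u(x,t)|\ge c\}|^{1/p'}\ge c .$$ In particular $c$ depends neither on $p$ nor on $u$.
   Context: Here $|E|$ denotes Lebesgue measure of a set $E\subseteq\mathbb{R}^{n+1}$, and $p'$ is defined by $1/p+1/p'=1$ with the convention $1/\infty=0$. When $p=1$ (so $1/p'=0$) the factor $|\{(x,t)\in\Omega:|u(x,t)|\ge c\}|^{1/p'}$ is interpreted as $1$, so that the inequality is just a lower bound on the $L^1$ norm. The norm $\|u\|_{L^p(\Omega)}$ is allowed to be $+\infty$. *)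

(* Defs.v *)
From HB Require Import structures.
From mathcomp Require Import all_boot all_order all_algebra.
From mathcomp Require Import all_classical all_reals all_analysis.

Set Implicit Arguments.
Unset Strict Implicit.
Unset Printing Implicit Defensive.
Import Order.TTheory GRing.Theory Num.Theory.
Import numFieldNormedType.Exports.

Local Open Scope classical_set_scope.
Local Open Scope ring_scope.

(* The product sigma-algebra on R^m, generated by the coordinates; it is the
   Borel sigma-algebra (open_measurable_rV below). *)
Definition rV_display : measure_display. Proof. exact. Qed.

Section measurable_rV.
Context (R : realType) (m : nat).

Definition rV_coord (i : 'I_m) (z : 'rV[R]_m) : R := z ord0 i.

Let rV_set0 : g_sigma_preimage rV_coord set0.
Proof. exact: sigma_algebra0. Qed.

Let rV_setC A : g_sigma_preimage rV_coord A -> g_sigma_preimage rV_coord (~` A).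
Proof. exact: sigma_algebraC. Qed.

Let rV_bigcup (F : _^nat) : (forall i, g_sigma_preimage rV_coord (F i)) ->
  g_sigma_preimage rV_coord (\bigcup_i (F i)).
Proof. exact: sigma_algebra_bigcup. Qed.

HB.instance Definition _ := @isMeasurable.Build rV_display
  'rV[R]_m (g_sigma_preimage rV_coord) rV_set0 rV_setC rV_bigcup.

Lemma measurable_rV_coord (i : 'I_m) : measurable_fun [set: 'rV[R]_m] (rV_coord i).
Proof.
move=> _ Y mY; rewrite setTI; apply: sub_sigma_algebra => /=.
rewrite -bigcup_seq/=; exists i => /=; first by rewrite mem_index_enum.
by exists Y => //; rewrite setTI.
Qed.

End measurable_rV.

Lemma measurable_fun_rV d (T : measurableType d) (R : realType) (m : nat)
    (f : T -> 'rV[R]_m) :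
  (forall i, measurable_fun [set: T] (@rV_coord R m i \o f)) ->
  measurable_fun [set: T] f.
Proof.
move=> mf _ A mA; rewrite setTI.
suff sub : g_sigma_preimage (@rV_coord R m) `<=` [set B | measurable (f @^-1` B)].
  exact: (sub A mA).
apply: smallest_sub; first split.
- by rewrite /= preimage_set0; exact: measurable0.
- by move=> B /= mB; rewrite setTD preimage_setC; apply: measurableC.
- by move=> F mF /=; rewrite preimage_bigcup; apply: bigcup_measurable => k _; exact: mF.
- move=> B; rewrite -bigcup_seq/= => -[i _ [C mC <-]] /=.
  by rewrite setTI -comp_preimage -[X in measurable X]setTI; exact: mf.
Qed.

(* The point (x, t) of R^n x R = R^(n+1); the last coordinate is the time. *)
Definition xt (R : realType) (n : nat) (p : 'rV[R]_n * measurableTypeR R) :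
    'rV[R]_n.+1 :=
  \row_i (if unlift ord_max i is Some j then p.1 ord0 j else p.2).

Lemma measurable_xt (R : realType) (n : nat) :
  measurable_fun [set: 'rV[R]_n * measurableTypeR R] (@xt R n).
Proof.
apply: measurable_fun_rV => i.
case: (unliftP ord_max i) => [j|] ->.
  rewrite (_ : _ \o _ = rV_coord j \o fst).
    by apply: measurableT_comp => //; exact: measurable_rV_coord.
  by apply/funext => p; rewrite /= /rV_coord mxE liftK.
rewrite (_ : _ \o _ = snd); first exact: measurable_snd.
by apply/funext => p; rewrite /= /rV_coord mxE unlift_none.
Qed.

(* Lebesgue measure on the Borel sets of R^m, as the m-fold product of the
   one-dimensional one; R^0 is a point of mass 1. *)
Fixpoint lebesgue_rV (R : realType) (m : nat) : set 'rV[R]_m -> \bar R :=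
  match m with
  | 0 => \d_(0 : 'rV[R]_0)
  | k.+1 => pushforward (@lebesgue_rV R k \x @lebesgue_measure R)%E (@xt R k)
  end.
Arguments lebesgue_rV {R} m.

Section lebesgue_rV_measure.
Context (R : realType).

Let lebesgue_rV_is_measure (m : nat) :
  exists mu : {measure set 'rV[R]_m -> \bar R}, mu = lebesgue_rV m :> (_ -> _).
Proof.
elim: m => [|m [mu muE]]; first by exists (\d_(0 : 'rV[R]_0)).
exists (measure_function_pushforward__canonical__measure_function_Measure
  (mu \x @lebesgue_measure R)%E (@measurable_xt R m)).
by rewrite /= -muE.
Qed.

Context (m : nat).

Let lebesgue_rV0 : lebesgue_rV m set0 = 0%E :> \bar R.
Proof. by have [mu <-] := lebesgue_rV_is_measure m; rewrite measure0. Qed.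

Let lebesgue_rV_ge0 (A : set 'rV[R]_m) : (0 <= lebesgue_rV m A)%E.
Proof. by have [mu <-] := lebesgue_rV_is_measure m; exact: measure_ge0. Qed.

Let lebesgue_rV_semi_sigma_additive :
  semi_sigma_additive (lebesgue_rV m : set 'rV[R]_m -> \bar R).
Proof.
have [mu <-] := lebesgue_rV_is_measure m; exact: measure_semi_sigma_additive.
Qed.

HB.instance Definition _ := isMeasure.Build _ _ _ (@lebesgue_rV R m)
  lebesgue_rV0 lebesgue_rV_ge0 lebesgue_rV_semi_sigma_additive.

End lebesgue_rV_measure.

Lemma lebesgue_rV_box (R : realType) (m : nat) (A : 'I_m -> set R) :
  (forall i, measurable (A i)) ->
  lebesgue_rV m [set z : 'rV[R]_m | forall i, A i (z ord0 i)] =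
  (\prod_(i < m) @lebesgue_measure R (A i))%E.
Proof.
elim: m A => [|m IH] A mA.
  by rewrite big_ord0 /= diracE mem_set// => -[].
rewrite big_ord_recr /= /pushforward.
pose B : set 'rV[R]_m := [set z | forall i, A (widen_ord (leqnSn m) i) (z ord0 i)].
have ordE i : widen_ord (leqnSn m) i = lift ord_max i :> 'I_m.+1.
  by apply: val_inj; rewrite /= /bump leqNgt ltn_ord.
have -> : @xt R m @^-1` [set z | forall i, A i (z ord0 i)] = B `*` A ord_max.
  apply/seteqP; split=> -[x t] /=.
    move=> H; split; first by move=> i; have := H (widen_ord (leqnSn m) i);
      rewrite ordE mxE liftK.
    by have := H ord_max; rewrite mxE unlift_none.
  move=> [Hx Ht] i; rewrite mxE; case: unliftP => [j|] -> //.
  by rewrite -ordE; exact: Hx.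
have mB : measurable B.
  rewrite (_ : B = \bigcap_(i in [set: 'I_m])
    (@rV_coord R m i @^-1` A (widen_ord (leqnSn m) i))).
    apply: fin_bigcap_measurable => // i _.
    by rewrite -[X in measurable X]setTI; exact: measurable_rV_coord.
  by apply/seteqP; split=> z /= H i => [_|]; exact: H.
rewrite product_measure1E//; last exact: mA.
congr (_ * _)%E; exact: (IH (fun i => A (widen_ord (leqnSn m) i))).
Qed.

Lemma open_measurable_rV (R : realType) (m : nat) (U : set 'rV[R]_m) :
  open U -> measurable U.
Proof.
move=> oU.
pose box (ab : 'rV[rat]_m * 'rV[rat]_m) : set 'rV[R]_m :=
  \bigcap_(i in [set: 'I_m])
    (@rV_coord R m i @^-1` `]ratr (ab.1 ord0 i), ratr (ab.2 ord0 i)[).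
pose F ab : set 'rV[R]_m := if `[< box ab `<=` U >] then box ab else set0.
have mbox ab : measurable (box ab).
  apply: fin_bigcap_measurable => // i _.
  by rewrite -[X in measurable X]setTI; exact: measurable_rV_coord.
have -> : U = \bigcup_ab F ab.
  apply/seteqP; split=> [z Uz|z [ab _]]; last first.
    by rewrite /F; case: ifPn => // /asboolP sub; exact: sub.
  move: oU; rewrite openE => /(_ _ Uz) /nbhs_ballP[e /= e0 eU].
  have /choice[a aP] : forall i, exists q : rat, ratr q \in `]z ord0 i - e, z ord0 i[.
    by move=> i; apply: rat_in_itvoo; rewrite ltrBlDr ltrDl.
  have /choice[b bP] : forall i, exists q : rat, ratr q \in `]z ord0 i, z ord0 i + e[.
    by move=> i; apply: rat_in_itvoo; rewrite ltrDl.
  exists (\row_i a i, \row_i b i) => //.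
  rewrite /F; case: asboolP => [_|].
    move=> i _ /=; rewrite /rV_coord !mxE in_itv/=.
    by have := aP i; have := bP i; rewrite !in_itv/= => /andP[-> _] /andP[_ ->].
  case=> y yab; apply: eU; split => // j i; rewrite (ord1 j).
  have := yab i I; rewrite /= /rV_coord !mxE in_itv/= => /andP[ay yb].
  have := aP i; have := bP i; rewrite !in_itv/= => /andP[_ be] /andP[ea _].
  rewrite /ball/= ltr_distlC (lt_trans ea ay)/=.
  exact: lt_trans yb be.
apply: countable_bigcupT_measurable; first exact: countableP.
by move=> ab; rewrite /F; case: ifP.
Qed.

Definition unit_vec (R : realType) (m : nat) (i : 'I_m) : 'rV[R]_m :=
  delta_mx ord0 i.

(* f is C^k on the open set Om: its iterated partial derivatives of order at
   most k exist and are continuous at every point of Om.  As Om is open, the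
   values of f outside Om are irrelevant. *)
Fixpoint Ck_on (R : realType) (m : nat) (Om : set 'rV[R]_m) (k : nat)
    (f : 'rV[R]_m -> R) : Prop :=
  (forall z, Om z -> {for z, continuous f}) /\
  match k with
  | 0 => True
  | j.+1 => forall i : 'I_m,
      (forall z, Om z -> derivable f z (@unit_vec R m i)) /\
      Ck_on Om j ('D_(@unit_vec R m i) f)
  end.

Definition smooth_on (R : realType) (m : nat) (Om : set 'rV[R]_m)
    (f : 'rV[R]_m -> R) : Prop :=
  forall k, Ck_on Om k f.

(* H = Delta_x - d/dt; lift ord_max enumerates the first n coordinates. *)
Definition heat (R : realType) (n : nat) (u : 'rV[R]_n.+1 -> R)
    (z : 'rV[R]_n.+1) : R :=
  (\sum_(i < n) 'D_(@unit_vec R n.+1 (lift ord_max i))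
                  ('D_(@unit_vec R n.+1 (lift ord_max i)) u) z)
  - 'D_(@unit_vec R n.+1 ord_max) u z.

(* Main.v *)
Require Import Defs.
From HB Require Import structures.
From mathcomp Require Import all_boot all_order all_algebra.
From mathcomp Require Import all_classical all_reals all_analysis.
From mathcomp Require Import measurable_realfun ess_sup_inf.
From mathcomp Require Import ring lra.

Set Implicit Arguments.
Unset Strict Implicit.
Unset Printing Implicit Defensive.
Import Order.TTheory GRing.Theory Num.Theory.
Import numFieldNormedType.Exports.

Local Open Scope classical_set_scope.
Local Open Scope ring_scope.

(** The idea is to test the inequality against a bump function.  Fix a closed
    cube Q inside Om, centred at a point a of Om with half-side r, and let
    phi(z) = prod_j ((z_j - a_j)^2 - r^2)^2.  This polynomial is nonnegative,
    and both phi and its gradient vanish on the boundary of Q, so integrating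
    by parts twice in each space variable and once in time gives
      int_Q phi (Hu) = int_Q (H* phi) u,   where H* = Delta_x + d/dt
    ([heat_duality]).  If Hu >= 1, the left-hand side is at least int_Q phi > 0,
    while the right-hand side is at most sup_Q |H* phi| times the L^1 norm of u
    on Q.  Hence int_Q |u| >= c0 with c0 > 0 independent of u
    ([L1_lower_bound]).

    The points of Q where |u| < c contribute at most c |Q| to that integral.
    With c = c0 / (1 + |Q|), the set E of the points of Om where |u| >= c
    therefore still carries int_E |u| >= c0 - c |Q| = c
    ([integral_superlevel]).  Hoelder's inequality for u and the indicator of E
    bounds int_E |u| by the left-hand side of the theorem, for all p at once
    ([hoelder_set]).

    Integration by parts rests on the divergence theorem on a cube, for vector
    fields whose normal component vanishes on the boundary
    ([cube_divergence]): on every line parallel to the i-th axis the integral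
    of the i-th partial derivative is zero by the fundamental theorem of
    calculus, and the integral over the space then vanishes by Fubini
    ([slice_integral0]). *)

(** * Cubes and integration along lines *)

Definition cube (R : realType) (m : nat) (a : 'rV[R]_m) (r : R) :
    set 'rV[R]_m :=
  [set z | forall i, z ord0 i \in `[a ord0 i - r, a ord0 i + r]].

Section cube_measure.
Context (R : realType) (m : nat).
Implicit Types (a z : 'rV[R]_m) (r : R).

Lemma measurable_cube a r : measurable (cube a r).
Proof.
rewrite (_ : cube a r = \bigcap_(i in [set: 'I_m])
    (@rV_coord R m i @^-1` `[a ord0 i - r, a ord0 i + r]%classic)).
  apply: fin_bigcap_measurable => // i _.
  by rewrite -[X in measurable X]setTI; exact: measurable_rV_coord.
by apply/seteqP; split=> z /= H i => [_|]; exact: H.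
Qed.

Lemma lebesgue_cube a r : 0 < r ->
  lebesgue_rV m (cube a r) = ((r *+ 2) ^+ m)%:E.
Proof.
move=> r0; rewrite (@lebesgue_rV_box R m
  (fun i => `[a ord0 i - r, a ord0 i + r]%classic)) //.
rewrite (eq_bigr (fun=> (r *+ 2)%:E)) => [|i _].
  by rewrite prodEFin prodr_const card_ord.
rewrite lebesgue_measure_itv /= lte_fin ltrD2l gtrN// -EFinD.
by congr (_%:E); rewrite opprD opprK addrACA subrr add0r mulr2n.
Qed.

(** Sigma-finiteness is what Fubini's theorem requires of the measure. *)
Lemma lebesgue_rV_sigma_finite : sigma_finite [set: 'rV[R]_m] (lebesgue_rV m).
Proof.
exists (fun k => cube 0 k.+1%:R).
  apply/seteqP; split => // z _.
  have [M zM] : exists M, forall i, `|z ord0 i| <= M.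
    exists (\sum_i `|z ord0 i|) => i.
    by rewrite (bigD1 i)//= lerDl sumr_ge0.
  exists (Num.truncn M) => // i; rewrite mxE in_itv/= sub0r add0r -ler_norml.
  exact: le_trans (zM i) (ltW (Num.Theory.truncnS_gt _)).
move=> k; split; first exact: measurable_cube.
by rewrite lebesgue_cube// ltry.
Qed.

HB.instance Definition _ := @Measure_isSigmaFinite.Build _ _ _
  (@lebesgue_rV R m) lebesgue_rV_sigma_finite.

Lemma cube_integrable a r (f : 'rV[R]_m -> R) :
  0 < r -> measurable_fun (cube a r) f ->
  [bounded f x | x in cube a r] ->
  (lebesgue_rV m).-integrable (cube a r) (EFin \o f).
Proof.
move=> r0 mf bf; apply: measurable_bounded_integrable => //.
  exact: measurable_cube.
by rewrite /= lebesgue_cube// ltry.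
Qed.

End cube_measure.

Section slices.
Context (R : realType).

Definition upd (m : nat) (z : 'rV[R]_m) (i : 'I_m) (s : R) : 'rV[R]_m :=
  \row_j (if j == i then s else z ord0 j).

Lemma upd_lift m (x : 'rV[R]_m) (j : 'I_m) (s t : R) :
  xt (upd x j s, t) = upd (xt (x, t)) (lift ord_max j) s.
Proof.
apply/rowP => k; rewrite !mxE; case: unliftP => [k'|] -> /=.
  by rewrite mxE (inj_eq lift_inj).
by rewrite eq_liftF.
Qed.

Lemma upd_max m (x : 'rV[R]_m) (s t : R) :
  xt (x, s) = upd (xt (x, t)) ord_max s.
Proof.
apply/rowP => k; rewrite !mxE; case: unliftP => [k'|] -> /=.
  by rewrite lift_eqF.
by rewrite eqxx.
Qed.

(** The measure is an iterated product that peels off the last coordinate, so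
    Fubini's theorem directly isolates that coordinate only.  Any other one is
    reached by induction on the dimension: integrating last over the last
    coordinate t leaves inside the function x |-> F (x, t), all of whose lines
    in the given direction are lines of F.  Boundedness and bounded support
    are hypotheses that every such restriction inherits, whereas integrability
    of F only passes to almost all of them. *)
Lemma slice_integral0 (m : nat) (i : 'I_m) (a : 'rV[R]_m) (r M : R)
    (F : 'rV[R]_m -> R) : 0 < r ->
    measurable_fun [set: 'rV[R]_m] F -> (forall z, `|F z| <= M) ->
    (forall z, ~ cube a r z -> F z = 0) ->
    (forall z, \int[@lebesgue_measure R]_s (F (upd z i s))%:E = 0)%E ->
  (\int[lebesgue_rV m]_z (F z)%:E = 0)%E.
Proof.
move=> r0; elim: m i a F => [[]//|m IH] i a F mF FM Fa F0.
have iF : (lebesgue_rV m.+1).-integrable setT (EFin \o F).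
  have -> : EFin \o F = (EFin \o F) \_ (cube a r).
    apply/funext => z; rewrite patchE; case: ifPn => // /negP.
    by rewrite inE => /Fa /= ->.
  apply/(integrable_mkcond _ (measurable_cube a r)).
  apply: cube_integrable => //; first exact: measurable_funTS.
  exists M; split; first exact: num_real.
  by move=> N MN z _ /=; exact: le_trans (FM z) (ltW MN).
have mxt := @measurable_xt R m.
have mEF : measurable_fun setT (EFin \o F) by exact/measurable_EFinP.
pose G : 'rV[R]_m * measurableTypeR R -> \bar R := (EFin \o F) \o @xt R m.
have iG : (lebesgue_rV m \x @lebesgue_measure R)%E.-integrable setT G.
  apply/integrableP; split; first exact: (measurableT_comp mEF mxt).
  case/integrableP: iF => _; apply: le_lt_trans.
  (* The measure in dimension m + 1 is the image by xt of the product
     measure. *)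
  rewrite -[X in (X <= _)%E]/(\int[(lebesgue_rV m \x @lebesgue_measure R)]_(x in
    @xt R m @^-1` setT) ((abse \o (EFin \o F)) \o @xt R m) x)%E.
  rewrite -ge0_integral_pushforward//; first exact: measurableT_comp.
  by move=> y _; exact: abse_ge0.
transitivity (\int[lebesgue_rV m \x @lebesgue_measure R]_z G z)%E.
  rewrite -[RHS]/(\int[(lebesgue_rV m \x @lebesgue_measure R)]_(x in
    @xt R m @^-1` setT) ((EFin \o F) \o @xt R m) x)%E.
  rewrite -(integral_pushforward mxt)//; exact/measurable_EFinP.
(* Any direction but the last: exchange the integrals and use induction.  Last
   direction: integrate over it first. *)
case: (unliftP ord_max i) => [j|] iE.
  rewrite -integral21_prod_meas1//; apply: integral0_eq => t _.
  rewrite /fubini_G /G /=.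
  apply: (IH j (\row_k a ord0 (lift ord_max k)) (fun x => F (xt (x, t)))).
  - apply: measurableT_comp => //.
    by apply: (measurableT_comp mxt); exact: measurable_pair2.
  - by move=> z; exact: FM.
  - move=> z nz; apply: Fa => Hz; apply: nz => k.
    by have := Hz (lift ord_max k); rewrite !mxE liftK.
  - by move=> z; under eq_integral do rewrite upd_lift -iE; exact: F0.
rewrite -integral12_prod_meas1//; apply: integral0_eq => x _.
rewrite /fubini_F /G /=.
by under eq_integral do rewrite (upd_max x _ 0) -iE; exact: F0.
Qed.

End slices.

(** * The divergence theorem on a cube *)

Section continuity_on_cubes.
Context (R : realType) (m : nat).
Implicit Types (Om : set 'rV[R]_m) (a z : 'rV[R]_m) (r : R) (f : 'rV[R]_m -> R).

Lemma continuous_measurable_rV Om f : open Om ->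
  (forall z, Om z -> {for z, continuous f}) -> measurable_fun Om f.
Proof.
move=> oOm cf; apply: (measurability _ (RGenOInfty.measurableE R)).
move=> /= _ [_ [b ->]] <-; apply: open_measurable_rV.
rewrite openE => z [Omz fz]; rewrite /interior.
apply: filterI; first exact: open_nbhs_nbhs.
by apply: (cf z Omz); apply: open_nbhs_nbhs; split => //; exact: interval_open.
Qed.

Lemma cube_compact a r : compact (cube a r).
Proof.
apply: (@rV_compact _ _ (fun i => `[a ord0 i - r, a ord0 i + r]%classic)) => i.
exact: segment_compact.
Qed.

Lemma cube_continuous_bounded Om a r f : cube a r `<=` Om ->
  (forall z, Om z -> {for z, continuous f}) -> [bounded f x | x in cube a r].
Proof.
move=> aOm cf; have [|M [Mr fM]] := @compact_bounded R R (f @` cube a r).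
  apply: continuous_compact; last exact: cube_compact.
  by apply: continuous_in_subspaceT => z /[1!inE] /aOm /cf.
exists M; split => // N MN z az; apply: (fM N MN).
by exists z.
Qed.

Lemma cube_continuous_integrable Om a r f : 0 < r -> open Om ->
  cube a r `<=` Om -> (forall z, Om z -> {for z, continuous f}) ->
  (lebesgue_rV m).-integrable (cube a r) (EFin \o f).
Proof.
move=> r0 oOm aOm cf; apply: cube_integrable => //.
  apply: (measurable_funS _ aOm); first exact: open_measurable_rV.
  exact: continuous_measurable_rV.
exact: cube_continuous_bounded cf.
Qed.

Lemma open_cube Om a : open Om -> Om a -> exists2 r, 0 < r & cube a r `<=` Om.
Proof.
rewrite openE => oOm /oOm /nbhs_ballP[e /= e0 eOm].
exists (e / 2); first by rewrite divr_gt0.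
move=> z az; apply: eOm; split => // k i; rewrite (ord1 k).
have := az i; rewrite in_itv/= -ler_distl distrC => zi.
rewrite /ball/=; apply: le_lt_trans zi _.
by rewrite ltr_pdivrMr// mulr2n mulrDr mulr1 ltrDl.
Qed.

Lemma updE (z : 'rV[R]_m) (i : 'I_m) (s : R) :
  upd z i s = s *: unit_vec R i + upd z i 0.
Proof.
apply/rowP => j; rewrite !mxE eqxx /=.
by have [_|_] := eqVneq j i; rewrite ?mulr1 ?addr0 ?mulr0 ?add0r.
Qed.

Lemma upd_id (z : 'rV[R]_m) (i : 'I_m) : upd z i (z ord0 i) = z.
Proof. by apply/rowP => j; rewrite mxE; case: eqP => [->|]. Qed.

Lemma upd_shift (z : 'rV[R]_m) (i : 'I_m) (h s : R) :
  h *: unit_vec R i + upd z i s = upd z i (h *: 1 + s).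
Proof. by rewrite updE addrA -scalerDl -updE /GRing.scale /= mulr1. Qed.

Lemma continuous_upd (z : 'rV[R]_m) (i : 'I_m) : continuous (upd z i).
Proof.
move=> s; rewrite (_ : upd z i = fun s => s *: unit_vec R i + upd z i 0).
  by apply: cvgD; [exact: scalel_continuous|exact: cvg_cst].
by apply/funext => t; exact: updE.
Qed.

(** Directional derivatives along a coordinate axis are ordinary derivatives
    along the corresponding line: the difference quotients coincide. *)
Lemma derivable_upd f (z : 'rV[R]_m) (i : 'I_m) (s : R) :
  derivable (f \o upd z i) s 1 <-> derivable f (upd z i s) (unit_vec R i).
Proof.
rewrite /derivable; set p := (fun h : R => _); set q := (fun h : R => _).
by have -> // : p = q; apply/funext => h; rewrite /p /q /= upd_shift.
Qed.

Lemma derive_upd f (z : 'rV[R]_m) (i : 'I_m) (s : R) :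
  'D_1 (f \o upd z i) s = 'D_(unit_vec R i) f (upd z i s).
Proof.
rewrite /derive; set p := (fun h : R => _); set q := (fun h : R => _).
by have -> // : p = q; apply/funext => h; rewrite /p /q /= upd_shift.
Qed.

(** On a line that meets the cube, the fundamental theorem of calculus
    evaluates the integral of the derivative as a difference of two values of w
    on opposite faces, where w vanishes; [slice_integral0] concludes. *)
Lemma cube_integral_partial Om a r (i : 'I_m) (w Dw : 'rV[R]_m -> R) :
    0 < r -> open Om -> cube a r `<=` Om ->
    (forall z, Om z -> is_derive z (unit_vec R i) w (Dw z)) ->
    (forall z, Om z -> {for z, continuous Dw}) ->
    (forall z, `|z ord0 i - a ord0 i| = r -> w z = 0) ->
  (\int[lebesgue_rV m]_(z in cube a r) (Dw z)%:E = 0)%E.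
Proof.
move=> r0 oOm aOm dw cw w0.
have mcube := measurable_cube a r.
have [M [_ DwM]] := cube_continuous_bounded aOm cw.
rewrite integral_mkcond.
rewrite (eq_integral (fun z => ((Dw \_ (cube a r)) z)%:E)); last first.
  by move=> z _; rewrite !patchE; case: ifP.
rewrite (@slice_integral0 R m i a r (`|M| + 1))//.
- apply/(measurable_restrictT _ mcube).
  apply: (measurable_funS _ aOm); first exact: open_measurable_rV.
  exact: continuous_measurable_rV.
- move=> z; rewrite patchE; case: ifPn => [|_].
    rewrite inE => az; apply: (DwM _ _ z az).
    by rewrite (le_lt_trans (ler_norm _))// ltrDl.
  by rewrite normr0 addr_ge0.
- by move=> z; rewrite patchE; case: ifPn => //; rewrite inE.
move=> z.
(* Only the coordinates other than i decide whether the line meets the cube. *)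
have [za|nza] := pselect (forall j, j != i ->
    z ord0 j \in `[a ord0 j - r, a ord0 j + r]); last first.
  apply: integral0_eq => s _; rewrite patchE; case: ifPn => //.
  rewrite inE => zs.
  case: nza => j ji; have := zs j; by rewrite mxE (negbTE ji).
set lo := a ord0 i - r; set hi := a ord0 i + r.
have zsP s : cube a r (upd z i s) <-> s \in `[lo, hi].
  split=> [/(_ i)|sI j]; rewrite mxE ?eqxx//.
  by case: eqVneq => [->//|ji]; exact: za.
have lohi : lo < hi by rewrite ltrD2l gtrN.
transitivity (\int[@lebesgue_measure R]_(s in `[lo, hi]) (Dw (upd z i s))%:E)%E.
  rewrite [RHS]integral_mkcond; apply: eq_integral.
  move=> s _; rewrite !patchE; have [sI|sI] := boolP (s \in `[lo, hi]).
    by rewrite !mem_set//; exact/zsP.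
  by rewrite !memNset// => [/=|/zsP]; exact/negP.
have dws s : s \in `[lo, hi] -> derivable (w \o upd z i) s 1.
  by move=> /zsP /aOm /dw[] dwz _; apply/derivable_upd.
have cws s : s \in `[lo, hi] -> {for s, continuous (w \o upd z i)}.
  by move=> /dws /derivable1_diffP /differentiable_continuous.
rewrite (@continuous_FTC2 R (Dw \o upd z i) (w \o upd z i) lo hi)//.
- rewrite /= !w0 ?subee// mxE eqxx /lo /hi addrAC subrr add0r ?normrN;
    by rewrite gtr0_norm.
- apply: continuous_in_subspaceT => s /[1!inE] /zsP /aOm /cw cD.
  by apply: continuous_comp => //; exact: continuous_upd.
- split.
  + by move=> s slh; apply: dws; apply: subset_itv_oo_cc slh.
  + by apply: cvg_at_right_filter; apply: cws; rewrite in_itv/= lexx ltW.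
  + by apply: cvg_at_left_filter; apply: cws; rewrite in_itv/= lexx ltW.
- move=> s /subset_itv_oo_cc /zsP /aOm /dw dws'.
  by rewrite derive1E derive_upd derive_val.
Qed.

Lemma cube_divergence Om a r (w Dw : 'I_m -> 'rV[R]_m -> R) :
    0 < r -> open Om -> cube a r `<=` Om ->
    (forall i z, Om z -> is_derive z (unit_vec R i) (w i) (Dw i z)) ->
    (forall i z, Om z -> {for z, continuous (Dw i)}) ->
    (forall i z, `|z ord0 i - a ord0 i| = r -> w i z = 0) ->
  (\int[lebesgue_rV m]_(z in cube a r) (\sum_i Dw i z)%:E = 0)%E.
Proof.
move=> r0 oOm aOm dw cw w0; under eq_integral do rewrite -sumEFin.
rewrite integral_sum.
- rewrite big1// => i _.
  by apply: (cube_integral_partial r0 oOm aOm (w := w i)); auto.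
- exact: measurable_cube.
- by move=> i; exact: (cube_continuous_integrable r0 oOm aOm (cw i)).
Qed.

End continuity_on_cubes.

(** * Duality for the heat operator *)

Section product_polynomials.
Context (R : realType) (m : nat).
Implicit Types (b : 'I_m -> {poly R}) (z : 'rV[R]_m).

Definition prodpoly b z : R := \prod_j (b j).[z ord0 j].

(** Replacing the i-th factor by its derivative differentiates the product
    along the i-th axis, since the other factors are constant there; the class
    of products is thus stable under partial derivatives. *)
Definition deriv_factor (i : 'I_m) b : 'I_m -> {poly R} :=
  fun j => if j == i then (b j)^`() else b j.

Lemma continuous_prodpoly b : continuous (prodpoly b).
Proof.
apply: continuous_big; first exact: mul_continuous.
move=> j _ z.
apply: (@continuous_comp _ _ _ (fun z => z ord0 j) (horner (b j))).
  exact: coord_continuous.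
exact: continuous_horner.
Qed.

Lemma prodpolyD1 b i z :
  prodpoly b z = (b i).[z ord0 i] * \prod_(j | j != i) (b j).[z ord0 j].
Proof. by rewrite /prodpoly (bigD1 i). Qed.

Lemma prodpoly_eq0 b i z : (b i).[z ord0 i] = 0 -> prodpoly b z = 0.
Proof. by move=> bi; rewrite (prodpolyD1 _ i) bi mul0r. Qed.

Lemma is_derive_prodpoly b i z :
  is_derive z (unit_vec R i) (prodpoly b) (prodpoly (deriv_factor i b) z).
Proof.
set c := \prod_(j | j != i) (b j).[z ord0 j].
have line : prodpoly b \o upd z i = horner (c *: b i).
  apply/funext => s; rewrite /= (prodpolyD1 _ i) mxE eqxx hornerZ mulrC.
  by congr (_ * _); apply: eq_bigr => j ji; rewrite mxE (negbTE ji).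
apply: DeriveDef.
  rewrite -(upd_id z i); apply/derivable_upd.
  by rewrite line; exact (@derivable_horner R (c *: b i) (z ord0 i)).
rewrite -{1}(upd_id z i) -derive_upd line derive_val derivZ hornerZ mulrC.
rewrite (prodpolyD1 _ i) /deriv_factor eqxx; congr (_ * _).
by apply: eq_bigr => j ji; rewrite (negbTE ji).
Qed.

End product_polynomials.

Section heat_duality.
Context (R : realType) (n : nat).
Notation V := 'rV[R]_n.+1.

(** This is (Delta_x + d/dt) phi for phi = prodpoly b, the last coordinate being
    the time. *)
Definition adjoint_heat (b : 'I_n.+1 -> {poly R}) (z : V) : R :=
  \sum_(i < n) prodpoly (deriv_factor (lift ord_max i)
                          (deriv_factor (lift ord_max i) b)) z
  + prodpoly (deriv_factor ord_max b) z.

(** With phi = prodpoly b, the integrand is the divergence of the field whose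
    i-th space component is phi d_i u - u d_i phi and whose time component is
    - phi u.  The assumption on b makes phi and d_i phi vanish on the faces
    orthogonal to the i-th axis, hence also the i-th component of the field. *)
Lemma heat_duality (Om : set V) (a : V) (r : R) (b : 'I_n.+1 -> {poly R})
    (u : V -> R) :
    0 < r -> open Om -> cube a r `<=` Om -> smooth_on Om u ->
    (forall j s, `|s - a ord0 j| = r ->
       (b j).[s] = 0 /\ (b j)^`().[s] = 0) ->
  (\int[lebesgue_rV n.+1]_(z in cube a r)
     (prodpoly b z * heat u z - adjoint_heat b z * u z)%:E = 0)%E.
Proof.
move=> r0 oOm aOm su b0.
have [cu du] := su 1%N.
have [_ d2u] := su 2%N.
pose W i : V -> R := if unlift ord_max i is Some _ then
  prodpoly b * ('D_(unit_vec R i) u) - prodpoly (deriv_factor i b) * u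
  else - (prodpoly b * u).
pose DW i (z : V) : R := if unlift ord_max i is Some _ then
  prodpoly b z * 'D_(unit_vec R i) ('D_(unit_vec R i) u) z -
  prodpoly (deriv_factor i (deriv_factor i b)) z * u z
  else - (prodpoly b z * 'D_(unit_vec R i) u z +
          prodpoly (deriv_factor i b) z * u z).
have deru i z : Om z -> is_derive z (unit_vec R i) u ('D_(unit_vec R i) u z).
  by move=> Omz; apply/derivableP; exact: (du i).1.
have der2u i z : Om z -> is_derive z (unit_vec R i) ('D_(unit_vec R i) u)
    ('D_(unit_vec R i) ('D_(unit_vec R i) u) z).
  by move=> Omz; apply/derivableP; exact: ((d2u i).2.2 i).1.
transitivity (\int[lebesgue_rV n.+1]_(z in cube a r) (\sum_i DW i z)%:E)%E.
  apply: eq_integral => z _; congr (_%:E).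
  rewrite (bigD1_ord ord_max)//= /DW unlift_none.
  under eq_bigr do rewrite liftK.
  rewrite sumrB -mulr_sumr -mulr_suml /heat /adjoint_heat.
  by ring.
apply: (cube_divergence r0 oOm aOm (w := W)).
- move=> i z Omz; rewrite /W /DW; case: unliftP => [k _|_].
    apply: is_derive_eq.
      apply: is_deriveB.
        by apply: is_deriveM; [exact: is_derive_prodpoly|exact: der2u].
      by apply: is_deriveM; [exact: is_derive_prodpoly|exact: deru].
    by rewrite /GRing.scale/=; ring.
  apply: is_derive_eq.
    by apply: is_deriveN; apply: is_deriveM;
      [exact: is_derive_prodpoly|exact: deru].
  by rewrite /GRing.scale/=; ring.
- have cb c z : {for z, continuous (@prodpoly R n.+1 c)}.
    exact: continuous_prodpoly.
  have cDu i z : Om z -> {for z, continuous ('D_(unit_vec R i) u)}.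
    by move=> Omz; exact: (du i).2.1.
  have cDDu i z : Om z ->
      {for z, continuous ('D_(unit_vec R i) ('D_(unit_vec R i) u))}.
    by move=> Omz; exact: ((d2u i).2.2 i).2.1.
  move=> i z Omz; rewrite /DW; case: unliftP => [k _|_].
    apply: (@cvgB _ _ _ (nbhs z)); apply: (@cvgM _ _ (nbhs z)).
    - exact: cb.
    - exact: cDDu.
    - exact: cb.
    - exact: cu.
  apply: (@cvgN _ _ _ (nbhs z)); apply: (@cvgD _ _ _ (nbhs z));
    apply: (@cvgM _ _ (nbhs z)).
  - exact: cb.
  - exact: cDu.
  - exact: cb.
  - exact: cu.
- move=> i z zi; have [bz dbz] := b0 i _ zi.
  have pb0 : prodpoly b z = 0 by exact: (prodpoly_eq0 (i := i)).
  have dpb0 : prodpoly (deriv_factor i b) z = 0.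
    by apply: (prodpoly_eq0 (i := i)); rewrite /deriv_factor eqxx.
  rewrite /W; case: unliftP => [k _|_].
    by rewrite !fctE pb0 dpb0 !mul0r subr0.
  by rewrite !fctE pb0 mul0r oppr0.
Qed.

End heat_duality.

(** * Reduction to a lower bound on the L1 norm *)

Section hoelder_set.
Local Open Scope ereal_scope.
Context d (T : measurableType d) (R : realType).
Variable mu : {measure set T -> \bar R}.
Implicit Types (f : T -> R) (E : set T).

(** Hoelder's inequality for f and the indicator of E, whose L^q norm is
    (mu E)^(1/q).  The two endpoints are direct: p = 1 is monotonicity of the
    integral, and for p = +oo the function is almost everywhere at most its
    essential supremum. *)
Lemma hoelder_set f E (p : \bar R) :
    measurable_fun [set: T] f -> measurable E -> 1 <= p ->
  \int[mu]_(x in E) `|(f x)%:E| <=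
    'N[mu]_p[EFin \o f] * mu E `^ fine (hoelder_conjugate p)^-1.
Proof.
move=> mf mE; have mnf : measurable_fun [set: T] (fun x => `|(f x)%:E|).
  by apply: measurableT_comp => //; exact/measurable_EFinP.
case: p => [r|_|//]; last first.
  rewrite hoelder_conjugatey inve1 /= poweRe1; last exact: measure_ge0.
  rewrite unlock; case: ifPn => [mu0|]; last first.
    rewrite -leNgt measure_le0 => /eqP muT.
    have muE : mu E = 0.
      by apply/eqP; rewrite -measure_le0 -muT le_measure ?inE.
    by rewrite mul0e null_set_integral//; exact: measurable_funTS.
  rewrite -integral_cst//; apply: ae_ge0_le_integral => //.
  - exact: measurable_funTS.
  - by move=> x _; apply: ess_sup_gee => //; apply/nearW => y /=.
  - have := ess_sup_ge mu (abse \o (EFin \o f)).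
    by apply: filterS => x.
rewrite lee_fin le_eqVlt => /predU1P[<-|r1].
  rewrite hoelder_conjugate1 invey /= poweRe0 mule1 Lnorm1.
  by apply: ge0_subset_integral.
have r0 : (0 < r)%R by exact: lt_trans r1.
have q0 : (0 < r / (r - 1))%R by rewrite divr_gt0// subr_gt0.
have qE : fine (hoelder_conjugate r%:E)^-1 = (r / (r - 1))^-1%R.
  rewrite /hoelder_conjugate/= eqe (gt_eqF r0) inver subr_eq0 (gt_eqF r1).
  by rewrite -EFinM inver (gt_eqF q0).
have mI : measurable_fun [set: T] (\1_E : T -> R) by exact: measurable_indic.
have pq : (r^-1 + (r / (r - 1))^-1 = 1)%R.
  by rewrite invf_div; field; rewrite (gt_eqF r0) // subr_eq0 (gt_eqF r1).
rewrite qE; have := hoelder mu mf mI r0 q0 pq; rewrite Lnorm1.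
have -> : 'N[mu]_(r / (r - 1))%:E[EFin \o (\1_E : T -> R)] =
    mu E `^ (r / (r - 1))^-1.
  rewrite unlock; congr (_ `^ _).
  transitivity (\int[mu]_x (\1_E x)%:E); last by rewrite integral_indic// setIT.
  apply: eq_integral => x _; rewrite /= ger0_norm// indicE.
  by case: (x \in E); rewrite ?powR1 ?powR0// gt_eqF.
apply: le_trans; rewrite integral_mkcond le_eqVlt; apply/orP; left.
apply/eqP/eq_integral => x _.
rewrite patchE /= indicE; case: (x \in E); first by rewrite mulr1.
by rewrite mulr0 normr0.
Qed.

(** On the part of A outside the superlevel set the integrand is at most c. *)
Lemma integral_superlevel f (A D : set T) (c : R) :
    (0 <= c)%R -> measurable A -> measurable D -> A `<=` D ->
    measurable_fun D f ->
  \int[mu]_(x in A) `|(f x)%:E| <=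
    \int[mu]_(x in D `&` [set x | (c <= `|f x|)%R]) `|(f x)%:E| + c%:E * mu A.
Proof.
move=> c0 mA mD AD mf; set E := D `&` _.
have mE : measurable E.
  have mnf : measurable_fun D (fun x => `|f x|%R) by exact: measurableT_comp.
  rewrite (_ : E = D `&` (fun x => `|f x|%R) @^-1` `[c, +oo[%classic).
    by apply: mnf => //; exact: measurable_itv.
  by apply/seteqP; split => x [Dx] /=; rewrite in_itv/= andbT.
have mnf : measurable_fun D (fun x => `|(f x)%:E|).
  by apply: measurableT_comp => //; exact/measurable_EFinP.
pose g := (fun x => `|(f x)%:E|) \_ E.
have g0 x : 0 <= g x by rewrite /g patchE; case: ifP.
have mg : measurable_fun [set: T] g.
  by apply/(measurable_restrictT _ mE); apply: measurable_funS mnf => // x [].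
have gE : \int[mu]_(x in E) `|(f x)%:E| = \int[mu]_x g x.
  by rewrite integral_mkcond.
apply: (@le_trans _ _ (\int[mu]_(x in A) (g x + c%:E))).
  apply: ge0_le_integral => //; first exact: measurable_funS mnf.
    by apply: emeasurable_funD => //; exact: measurable_funTS.
  move=> x Ax; rewrite /g patchE; case: ifPn => [_|].
    by rewrite leeDl// lee_fin.
  rewrite add0e notin_setE /E => nE; rewrite /= lee_fin leNgt.
  by apply/negP => cf; apply: nE; split; [exact: AD|exact: ltW].
rewrite ge0_integralD//; last exact: measurable_funTS.
by rewrite integral_cst// leeD2r// gE ge0_subset_integral.
Qed.

End hoelder_set.

(** * The lower bound on the L1 norm *)

Section L1_lower_bound.
Context (R : realType).

(** The outer square makes the derivative vanish, together with the polynomial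
    itself, at both ends of the interval of centre a and half-length r. *)
Definition bump (a r : R) : {poly R} := (('X - a%:P) ^+ 2 - (r ^+ 2)%:P) ^+ 2.

Lemma hornerbump a r s : (bump a r).[s] = ((s - a) ^+ 2 - r ^+ 2) ^+ 2.
Proof. by rewrite /bump !hornerE. Qed.

Lemma bump_ge0 a r s : 0 <= (bump a r).[s].
Proof. by rewrite hornerbump sqr_ge0. Qed.

Lemma bump_boundary a r s : `|s - a| = r ->
  (bump a r).[s] = 0 /\ (bump a r)^`().[s] = 0.
Proof.
move=> sar; have e : (s - a) ^+ 2 - r ^+ 2 = 0.
  by rewrite -sar real_normK ?num_real// subrr.
rewrite hornerbump e expr0n; split => //.
rewrite /bump deriv_exp hornerMn hornerM horner_exp !hornerE e.
by rewrite mulr0 mul0rn.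
Qed.

(** At distance at most r / 2 from a, r^2 - (s - a)^2 is at least 3 r^2 / 4. *)
Lemma bump_half a r s : s \in `[a - r / 2, a + r / 2] ->
  (3 / 4 * r ^+ 2) ^+ 2 <= (bump a r).[s].
Proof.
rewrite in_itv/= hornerbump => /andP[s1 s2]; rewrite -[leRHS]sqrrN opprB.
have h : (s - a) ^+ 2 <= r ^+ 2 / 4 by nra.
by apply: lerXn2r; rewrite ?nnegrE; nra.
Qed.

Variable n : nat.
Notation V := 'rV[R]_n.+1.

Lemma continuous_heat (Om : set V) (u : V -> R) : smooth_on Om u ->
  forall z, Om z -> {for z, continuous (heat u)}.
Proof.
move=> su z Omz; apply: (@cvgB _ _ _ (nbhs z)).
  apply: cvg_big; first exact: add_continuous.
  by move=> i _; exact: (((su 2%N).2 _).2.2 _).2.1.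
exact: ((su 1%N).2 _).2.1.
Qed.

Lemma continuous_adjoint_heat (b : 'I_n.+1 -> {poly R}) :
  continuous (adjoint_heat b).
Proof.
move=> z; apply: (@cvgD _ _ _ (nbhs z)); last exact: continuous_prodpoly.
apply: cvg_big; first exact: add_continuous.
by move=> i _; exact: continuous_prodpoly.
Qed.

(** For phi the product of the bumps and K = (Delta_x + d/dt) phi, one has
    pointwise phi - M |u| <= phi (Hu) - K u on the cube, where M bounds |K|
    there.  The right-hand side integrates to zero by [heat_duality], so the
    integral of phi is at most M times the L^1 norm of u. *)
Lemma L1_lower_bound (Om : set V) (a : V) (r : R) :
    0 < r -> open Om -> cube a r `<=` Om ->
  exists2 c : R, 0 < c & forall u : V -> R,
    smooth_on Om u -> (forall z, Om z -> 1 <= heat u z) ->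
    (c%:E <= \int[lebesgue_rV n.+1]_(z in cube a r) `|(u z)%:E|)%E.
Proof.
move=> r0 oOm aOm; pose b j := bump (a ord0 j) r.
set phi := prodpoly b; set K := adjoint_heat b.
have cphi : continuous phi by exact: continuous_prodpoly.
have cK : continuous K by exact: continuous_adjoint_heat.
have phi0 z : 0 <= phi z by apply: prodr_ge0 => j _; exact: bump_ge0.
have mQ := measurable_cube a r.
have [M M0 KM] : exists2 M, 0 < M & forall z, cube a r z -> `|K z| <= M.
  have [M [_ KM]] := @cube_continuous_bounded R _ setT a r K (@subsetT _ _)
    (fun z _ => cK z).
  exists (`|M| + 1); first by rewrite ltr_wpDl.
  move=> z az; apply: (KM _ _ z az).
  by rewrite (le_lt_trans (ler_norm _))// ltrDl.
have [A A0 phiA] : exists2 A, 0 < A &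
    (A%:E <= \int[lebesgue_rV n.+1]_(z in cube a r) (phi z)%:E)%E.
  (* A is d times the measure of the concentric cube of half the size, on which
     phi >= d. *)
  pose d := ((3 / 4 * r ^+ 2) ^+ 2) ^+ n.+1.
  have d0 : 0 < d by rewrite !exprn_gt0// mulr_gt0// exprn_gt0.
  have r20 : 0 < r / 2 by rewrite divr_gt0.
  exists (d * (r / 2 *+ 2) ^+ n.+1).
    by rewrite mulr_gt0// exprn_gt0// pmulrn_lgt0.
  rewrite EFinM -(lebesgue_cube a r20).
  have sub : cube a (r / 2) `<=` cube a r.
    move=> z az j; have := az j; rewrite !in_itv/= => /andP[z1 z2].
    by apply/andP; split; lra.
  have mphi : measurable_fun (cube a r) (EFin \o phi).
    apply/measurable_EFinP; apply: measurable_funTS.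
    exact: (@continuous_measurable_rV R n.+1 setT phi openT
      (fun z _ => cphi z)).
  rewrite -integral_cst; last exact: measurable_cube.
  apply: (@le_trans _ _
    (\int[lebesgue_rV n.+1]_(z in cube a (r / 2)) (phi z)%:E)%E).
    apply: ge0_le_integral => //.
    - exact: measurable_cube.
    - by move=> z _; rewrite lee_fin ltW.
    - exact: measurable_funS mphi.
    - move=> z az; rewrite lee_fin /d /phi /prodpoly.
      rewrite -[n.+1 in leLHS]card_ord -prodr_const; apply: ler_prod => j _.
      by rewrite sqr_ge0 bump_half.
  apply: ge0_subset_integral => //; first exact: measurable_cube.
  by move=> z _; rewrite lee_fin.
exists (A / M); first by rewrite divr_gt0.
move=> u su hu; have cu := (su 0%N).1.
have integ f := @cube_continuous_integrable R _ Om a r f r0 oOm aOm.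
have iphi : (lebesgue_rV n.+1).-integrable (cube a r) (EFin \o phi).
  by apply: integ => z _; exact: cphi.
have iu : (lebesgue_rV n.+1).-integrable (cube a r)
    (EFin \o (fun z => M * `|u z|)).
  apply: integ => z Omz; apply: (@cvgM _ _ (nbhs z)); first exact: cvg_cst.
  by apply: cvg_norm; exact: cu.
have ih : (lebesgue_rV n.+1).-integrable (cube a r)
    (EFin \o (fun z => phi z * heat u z - K z * u z)).
  apply: integ => z Omz; apply: (@cvgB _ _ _ (nbhs z));
    apply: (@cvgM _ _ (nbhs z)).
  - exact: cphi.
  - exact: (continuous_heat su).
  - exact: cK.
  - exact: cu.
have le0 : (\int[lebesgue_rV n.+1]_(z in cube a r)
    (phi z - M * `|u z|)%:E <= 0)%E.
  rewrite -(heat_duality r0 oOm aOm su (b := b)); last first.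
    by move=> j s; exact: bump_boundary.
  apply: le_integral => //; first exact: (integrableB mQ iphi iu).
  move=> z /[1!inE] az; rewrite lee_fin lerB//.
    by rewrite ler_peMr// hu//; exact: aOm.
  by rewrite (le_trans (ler_norm _))// normrM ler_wpM2r// KM.
rewrite -(@lee_pmul2l _ M%:E)// -EFinM.
have -> : M * (A / M) = A by rewrite mulrC divfK// gt_eqF.
rewrite -ge0_integralZl//; last 2 first.
- apply: measurableT_comp => //; apply/measurable_EFinP.
  apply: (measurable_funS _ aOm); first exact: open_measurable_rV.
  exact: continuous_measurable_rV.
- by rewrite lee_fin ltW.
apply: (le_trans phiA).
have intB := integralB mQ iphi iu.
by move: le0; rewrite [leLHS]intB sube_le0.
Qed.

End L1_lower_bound.

Theorem theorem2 (R : realType) (n : nat) (hn : (0 < n)%N)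
    (Om : set 'rV[R]_n.+1) (Om_nonempty : Om !=set0) (Om_open : open Om)
    (Om_bounded : bounded_set Om) :
  exists c : R, 0 < c /\
    forall u : 'rV[R]_n.+1 -> R,
      smooth_on Om u ->
      (forall z, Om z -> 1 <= heat u z) ->
      forall p : \bar R, (1 <= p)%E ->
        (c%:E <=
          'N[lebesgue_rV n.+1]_p[(EFin \o u) \_ Om] *
          (lebesgue_rV n.+1 (Om `&` [set z | (c <= `|u z|)%R]))
            `^ fine ((hoelder_conjugate p)^-1))%E.
Proof.
have [a Oma] := Om_nonempty.
have [r r0 aOm] := open_cube Om_open Oma.
have [c0 c00 L1] := @L1_lower_bound R n Om a r r0 Om_open aOm.
pose lam := (r *+ 2) ^+ n.+1.
have lam0 : 0 < lam by rewrite exprn_gt0// pmulrn_lgt0.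
have D0 : 0 < 1 + lam by rewrite addr_gt0.
(* This c solves c0 - c * lam = c. *)
pose c := c0 / (1 + lam).
have c_gt0 : 0 < c by rewrite divr_gt0.
exists c; split => // u su hu p p1; set E := Om `&` _.
have cu := (su 0%N).1.
have mOm := open_measurable_rV Om_open.
have mu := continuous_measurable_rV Om_open cu.
have mE : measurable E.
  have mnu : measurable_fun Om (fun x => `|u x|) by exact: measurableT_comp.
  rewrite (_ : E = Om `&` (fun x => `|u x|) @^-1` `[c, +oo[%classic).
    by apply: mnu => //; exact: measurable_itv.
  by apply/seteqP; split => x [Dx] /=; rewrite in_itv/= andbT.
have cE : (c%:E <= \int[lebesgue_rV n.+1]_(z in E) `|(u z)%:E|)%E.
  have := le_trans (L1 u su hu)
    (integral_superlevel (lebesgue_rV n.+1) (ltW c_gt0)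
      (measurable_cube a r) mOm aOm mu).
  rewrite -/E [X in (_ + _ * X)%E](lebesgue_cube a r0) -/lam -EFinM -leeBlDr//.
  apply: le_trans; rewrite -EFinB lee_fin /c.
  by rewrite le_eqVlt; apply/orP; left; apply/eqP; field; rewrite gt_eqF.
apply: (le_trans cE).
have -> : (EFin \o u) \_ Om = EFin \o (u \_ Om).
  by apply/funext => z; rewrite /= !patchE; case: ifP.
have muOm : measurable_fun setT (u \_ Om) by exact/(measurable_restrictT _ mOm).
apply: le_trans (hoelder_set (lebesgue_rV n.+1) muOm mE p1).
rewrite le_eqVlt; apply/orP; left; apply/eqP/eq_integral => z.
by rewrite inE => -[Omz _]; rewrite patchE mem_set.
Qed.
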